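(* Let $r,k \in \mathbb{N}$, let $(G,+)$ be an abelian group, and let $A \subseteq G$ be a union of $k$ generalised arithmetic progressions in $G$, each of which is either bounded or unbounded. Then there exists a natural number $l$ such that $A$ is an asymptotic $(r,l)$-approximate group.
   Context: $\mathbb{N}$ denotes the set of positive integers. For a subset $A$ of an abelian group $(G,+)$ and $n \in \mathbb{N}$, $nA := \{a_1+\cdots+a_n : a_1,\ldots,a_n \in A\}$ denotes the $n$-fold sum set. For subsets $X, Y$ of $G$, $X+Y := \{x+y : x\in X, y\in Y\}$. A subset of $G$ is an unbounded generalised arithmetic progression of dimension $d$ if it has the form $P(a,b_1,\ldots,b_d) := \{a+n_1b_1+\cdots+n_db_d : n_1,\ldots,n_d \in \mathbb{Z}_{\geq 0}\}$ for some $a,b_1,\ldots,b_d \in G$. A subset of $G$ is a bounded generalised arithmetic progression of dimension $d$ if it has the form $P_{m_1,\ldots,m_d}(a,b_1,\ldots,b_d) := \{a+n_1b_1+\cdots+n_db_d : n_i \in [0,m_i]\cap\mathbb{Z},\ 1\leq i\leq d\}$ for some $a,b_1,\ldots,b_d \in G$ and $m_1,\ldots,m_d\in\mathbb{Z}_{\geq 0}$. (The $k$ progressions in the union may have different dimensions.) For $r,l\in\mathbb{N}$, a subset $A \subseteq G$ is an asymptotic $(r,l)$-approximate group if there exists $h_0 \in \mathbb{N}$ such that for every natural number $h \geq h_0$ there is a set $X_h \subseteq G$ with $|X_h| \leq l$ and $(hr)A \subseteq X_h + hA$. *)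

(* Defs.v *)
From mathcomp Require Import all_boot all_algebra.
From mathcomp Require Import all_classical.

Set Implicit Arguments.
Unset Strict Implicit.
Unset Printing Implicit Defensive.

Import GRing.Theory.

Local Open Scope classical_set_scope.
Local Open Scope ring_scope.
Local Open Scope card_scope.

Definition sumset (G : zmodType) (X Y : set G) : set G :=
  [set z | exists x y, [/\ X x, Y y & z = x + y]].

Definition nsumset (G : zmodType) (n : nat) (A : set G) : set G :=
  [set z | exists a : 'I_n -> G, (forall i, A (a i)) /\ z = \sum_(i < n) a i].

Definition unbounded_prog (G : zmodType) (d : nat) (a : G) (b : 'I_d -> G) :
    set G :=
  [set x | exists n : 'I_d -> nat, x = a + \sum_(i < d) b i *+ n i].

Definition bounded_prog (G : zmodType) (d : nat) (m : 'I_d -> nat) (a : G)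
    (b : 'I_d -> G) : set G :=
  [set x | exists n : 'I_d -> nat,
    (forall i, (n i <= m i)%N) /\ x = a + \sum_(i < d) b i *+ n i].

(* The dimension d = 0 is allowed: it yields the singletons, which also arise
   as bounded progressions of dimension 1 with m = 0. *)
Definition unbounded_gap (G : zmodType) (d : nat) (P : set G) : Prop :=
  exists (a : G) (b : 'I_d -> G), P = unbounded_prog a b.

Definition bounded_gap (G : zmodType) (d : nat) (P : set G) : Prop :=
  exists (m : 'I_d -> nat) (a : G) (b : 'I_d -> G), P = bounded_prog m a b.

Definition gap (G : zmodType) (P : set G) : Prop :=
  exists d : nat, bounded_gap d P \/ unbounded_gap d P.

(* `I_l is the set {0, ..., l - 1}, so the cardinality condition says that
   X is finite with at most l elements. *)
Definition asymptotic_approx_group (G : zmodType) (r l : nat) (A : set G) :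
    Prop :=
  exists h0 : nat, (0 < h0)%N /\
    forall h : nat, (h0 <= h)%N ->
      exists X : set G,
        X #<= `I_l /\ nsumset (h * r)%N A `<=` sumset X (nsumset h A).

(* Main.v *)
Require Import Defs.
From mathcomp Require Import all_boot all_algebra.
From mathcomp Require Import all_classical.
From mathcomp Require Import zify.

Set Implicit Arguments.
Unset Strict Implicit.
Unset Printing Implicit Defensive.

Import GRing.Theory.

Local Open Scope classical_set_scope.

(** The idea is to forget the shape of the progressions.  A bounded progression
    is a finite set of points, and an unbounded one is a translate of a
    submonoid of [G]; so [A] is a finite union of translates [a t + S t] of
    submonoids, the points being translates of the trivial submonoid
    ([gap_monoid_translates],
    [bigcup_monoid_translates]).

    For such an [A], an element of [nsumset n A] is a sum
    [\sum_t (a t *+ m t + s t)] with [\sum_t m t = n], with [s t] in [S t] and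
    with [s t = 0] as soon as [m t = 0] ([nsumset_multiplicities] and its
    converse [mem_nsumset_multiplicities]).  The number of summands taken from
    a translate matters to the submonoid part only through its being zero or
    not.  Hence, to cover [nsumset (h * r) A] by translates of [nsumset h A],
    one may keep [s] and only has to replace the multiplicities [m], of total
    [h * r], by multiplicities [g] of total [h] with the same support, in such
    a way that the differences [m - g] range over a set of bounded size.

    This is done by rounding: with [M = h %/ #|T|], each [m t] is lowered by
    the largest multiple of [M] that leaves it positive, which leaves at most
    [M]; one index [t0] of the support receives what is missing to reach the
    total [h].  The difference is then determined by [t0] and by the quotients,
    which are at most [2 * #|T| * r] because [h <= 2 * #|T| * M]
    ([rounded_multiplicities]). *)

(** * Finite unions of translates of submonoids *)

Definition submonoid (G : zmodType) (S : set G) : Prop :=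
  S 0%R /\ forall x y, S x -> S y -> S (x + y)%R.

Definition union_monoid_translates (G : zmodType) (A : set G) : Prop :=
  exists (T : finType) (a : T -> G) (S : T -> set G),
    (forall t, submonoid (S t)) /\
    forall x, A x <-> exists t s, S t s /\ x = (a t + s)%R.

Lemma submonoid_sum (G : zmodType) (S : set G) (I : finType) (P : pred I)
    (F : I -> G) :
  submonoid S -> (forall i, P i -> S (F i)) -> S (\sum_(i | P i) F i)%R.
Proof. by move=> [S0 SD] SF; apply: big_ind. Qed.

Lemma submonoid_span (G : zmodType) (d : nat) (b : 'I_d -> G) :
  submonoid [set x | exists n : 'I_d -> nat, x = (\sum_(i < d) b i *+ n i)%R].
Proof.
split; first by exists (fun=> 0%N); rewrite big1 // => i _; rewrite mulr0n.
move=> _ _ [m ->] [n ->]; exists (fun i => (m i + n i)%N).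
by rewrite -big_split /=; apply: eq_bigr => i _; rewrite mulrnDr.
Qed.

Lemma submonoid0 (G : zmodType) : submonoid [set (0 : G)%R].
Proof. by split=> // _ _ -> ->; rewrite /= addr0. Qed.

Lemma unbounded_prog_monoid_translates (G : zmodType) (d : nat) (a : G)
    (b : 'I_d -> G) :
  union_monoid_translates (unbounded_prog a b).
Proof.
exists unit, (fun=> a), (fun=> [set x | exists n : 'I_d -> nat,
  x = (\sum_(i < d) b i *+ n i)%R]).
split=> [_|x]; first exact: submonoid_span.
split=> [[n ->]|[_ [_ [[n ->] ->]]]]; last by exists n.
by exists tt; eexists; split; first by exists n.
Qed.

Lemma bounded_prog_monoid_translates (G : zmodType) (d : nat)
    (m : 'I_d -> nat) (a : G) (b : 'I_d -> G) :
  union_monoid_translates (bounded_prog m a b).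
Proof.
pose box := {dffun forall i : 'I_d, 'I_(m i).+1}.
exists box, (fun n : box => a + \sum_(i < d) b i *+ n i)%R, (fun=> [set 0%R]).
split=> [_|x]; first exact: submonoid0.
split=> [[n [le_nm ->]]|[n [_ [-> ->]]]]; last first.
  exists (fun i => n i : nat); rewrite addr0; split=> // i.
  by rewrite -ltnS ltn_ord.
exists ([ffun i => inord (n i)] : box), 0%R; split=> //; rewrite addr0.
by congr (_ + _)%R; apply: eq_bigr => i _; rewrite ffunE inordK // ltnS.
Qed.

Lemma gap_monoid_translates (G : zmodType) (P : set G) :
  gap P -> union_monoid_translates P.
Proof.
move=> [d [[m [a [b ->]]]|[a [b ->]]]].
  exact: bounded_prog_monoid_translates.
exact: unbounded_prog_monoid_translates.
Qed.

Lemma bigcup_monoid_translates (G : zmodType) (I : finType) (P : I -> set G) :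
  (forall i, union_monoid_translates (P i)) ->
  union_monoid_translates (\bigcup_i P i).
Proof.
move=> P_union.
(* The index type depends on [i], so the choice of the data has to be made in
   [Type]. *)
have /all_tag[T /all_tag[a /all_tag[S PE]]] i :
    {T : finType & {a : T -> G & {S : T -> set G &
      (forall t, submonoid (S t)) /\
      forall x, P i x <-> exists t s, S t s /\ x = (a t + s)%R}}}.
  have [T /cid [a /cid [S PE]]] := cid (P_union i).
  by exists T, a, S.
exists {i : I & T i}, (fun t => a (tag t) (tagged t)),
  (fun t => S (tag t) (tagged t)).
split=> [[i t]|x]; first by case: (PE i) => + _; apply.
split=> [[i _ /(PE i).2[t [s [Ss ->]]]]|[[i t] [s [Ss ->]]]].
  by exists (Tagged T t), s.
by exists i => //; apply/(PE i).2; exists t, s.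
Qed.

(** * Sumsets described by multiplicities *)

Lemma nsumset0 (G : zmodType) (A : set G) : nsumset 0 A 0%R.
Proof. by exists (fun=> 0%R); split=> [[]//|]; rewrite big_ord0. Qed.

Lemma nsumsetD (G : zmodType) (A : set G) (m n : nat) (x y : G) :
  nsumset m A x -> nsumset n A y -> nsumset (m + n) A (x + y)%R.
Proof.
move=> [u [Au ->]] [v [Av ->]].
exists (fun i : 'I_(m + n) => match fintype.split i with inl j => u j | inr j => v j end).
split=> [i|]; first by case: (fintype.split i).
rewrite big_split_ord /=; congr (_ + _)%R; apply: eq_bigr => i _.
  by rewrite (unsplitK (inl i)).
by rewrite (unsplitK (inr i)).
Qed.

Lemma nsumset1 (G : zmodType) (A : set G) (x : G) : A x -> nsumset 1 A x.
Proof. by exists (fun=> x); rewrite big_ord1. Qed.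

Section Multiplicities.

Variables (G : zmodType) (T : finType) (a : T -> G) (S : T -> set G).
Variable A : set G.
Hypothesis S_monoid : forall t, submonoid (S t).
Hypothesis AE : forall x, A x <-> exists t s, S t s /\ x = (a t + s)%R.

Lemma nsumset_multiplicities (n : nat) (z : G) :
  nsumset n A z ->
  exists (m : T -> nat) (s : T -> G),
    [/\ (\sum_t m t)%N = n, forall t, S t (s t),
        forall t, m t = 0%N -> s t = 0%R
      & z = (\sum_t (a t *+ m t + s t))%R].
Proof.
move=> [x [Ax ->]].
have /choice [t /choice [s xE]] : forall i, exists t s, S t s /\ x i = (a t + s)%R.
  by move=> i; apply/AE.
exists (fun u => \sum_(i < n | t i == u) 1)%N,
  (fun u => \sum_(i < n | t i == u) s i)%R.
split.
- by rewrite -[RHS]card_ord -sum1_card (partition_big t predT).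
- by move=> u; apply: submonoid_sum => // i /eqP <-; case: (xE i).
- move=> u /eqP; rewrite sum_nat_eq0 => /forall_inP no_summand.
  by rewrite big1 // => i /no_summand.
- rewrite (partition_big t predT) //=; apply: eq_bigr => u _.
  rewrite -sumrMnr -big_split /=; apply: eq_bigr => i /eqP <-.
  by rewrite mulr1n; case: (xE i).
Qed.

(** All of the submonoid part can be carried by one of the summands, whence the
    condition that there be at least one. *)
Lemma mem_nsumset_translate (t : T) (m : nat) (s : G) :
  S t s -> (m = 0%N -> s = 0%R) -> nsumset m A (a t *+ m + s)%R.
Proof.
have Aa u : S t u -> nsumset 1 A (a t + u)%R.
  by move=> Su; apply/nsumset1/AE; exists t, u.
case: m => [_ /(_ erefl) ->|m Ss _]; first by rewrite addr0; exact: nsumset0.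
rewrite mulrSr -addrA -addn1; apply: nsumsetD (Aa _ Ss).
elim: m => [|m IHm]; first exact: nsumset0.
rewrite mulrSr -addn1; apply: nsumsetD IHm _.
by rewrite -[a t]addr0; apply: Aa; case: (S_monoid t).
Qed.

Lemma mem_nsumset_multiplicities (m : T -> nat) (s : T -> G) :
  (forall t, S t (s t)) -> (forall t, m t = 0%N -> s t = 0%R) ->
  nsumset (\sum_t m t)%N A (\sum_t (a t *+ m t + s t))%R.
Proof.
move=> Ss s0; apply: (big_ind2 (fun n z => nsumset n A z)) => [|n x p y|t _].
- exact: nsumset0.
- exact: nsumsetD.
- exact: mem_nsumset_translate (s0 t).
Qed.

(** Measuring all the translates from [a t0] separates the total of the
    multiplicities from their distribution. *)
Lemma sum_mulrn_recenter (t0 : T) (m : T -> nat) :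
  (\sum_t a t *+ m t =
   a t0 *+ (\sum_t m t)%N + \sum_t (a t - a t0) *+ m t)%R.
Proof.
rewrite -sumrMnr -big_split /=; apply: eq_bigr => t _.
by rewrite -mulrnDl addrC subrK.
Qed.

End Multiplicities.

(** * Rounding the multiplicities *)

(** Lowering [m t] by [M * ((m t).-1 %/ M)] leaves a number in [1, M] if
    [m t] is positive, and [0] otherwise.  As [#|T| * M <= h], the indices other
    than [t0] keep at most [h - M] altogether, so that a positive multiplicity
    is left for [t0]. *)
Lemma rounded_multiplicities (T : finType) (r h : nat) (m : T -> nat) :
  (0 < r)%N -> (#|T| < h)%N -> (\sum_t m t)%N = (h * r)%N ->
  exists (t0 : T) (c : {ffun T -> 'I_(2 * #|T| * r).+1}) (g : T -> nat),
    [/\ (\sum_t g t)%N = h, forall t, g t = 0%N -> m t = 0%N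
      & forall t, t != t0 -> m t = (h %/ #|T| * c t + g t)%N].
Proof.
move=> r_gt0 lt_Th sum_m; set M := (h %/ #|T|)%N.
have [t0 m0] : exists t0, (0 < m t0)%N.
  apply/not_existsP => m0; have : (0 < h * r)%N by rewrite muln_gt0 r_gt0; lia.
  rewrite -sum_m big1 // => t _; apply/eqP; rewrite -leqn0 leqNgt.
  exact/negP/m0.
have T_gt0 : (0 < #|T|)%N by apply/card_gt0P; exists t0.
have M_gt0 : (0 < M)%N by rewrite divn_gt0 // ltnW.
pose q t := ((m t).-1 %/ M)%N.
have q_le t : (q t <= 2 * #|T| * r)%N.
  have m_le : (m t <= h * r)%N by rewrite -sum_m (bigD1 t) //= leq_addr.
  have h_le : (h <= 2 * #|T| * M)%N.
    have := ltn_ceil h T_gt0; rewrite -/M; nia.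
  rewrite -ltnS ltn_divLR //; nia.
pose c := [ffun t => inord (q t) : 'I_(2 * #|T| * r).+1].
have cE t : c t = q t :> nat by rewrite ffunE inordK // ltnS.
pose e t := (m t - M * q t)%N.
have mE t : m t = (M * q t + e t)%N.
  rewrite /e subnKC // mulnC (leq_trans (leq_trunc_div _ _)) //.
  exact: leq_pred.
have e_le t : (e t <= M)%N.
  have := ltn_ceil (m t).-1 M_gt0; rewrite -/(q t) /e; nia.
have e_eq0 t : e t = 0%N -> m t = 0%N.
  have := leq_trunc_div (m t).-1 M; rewrite -/(q t) /e; nia.
have sum_e : (\sum_(t | t != t0) e t < h)%N.
  have : (\sum_(t | t != t0) e t <= \sum_(t | t != t0) M)%N by exact: leq_sum.
  rewrite sum_nat_const => /leq_ltn_trans; apply.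
  have -> : #|[pred t | t != t0]| = #|T|.-1 by rewrite cardC1.
  have := leq_trunc_div h #|T|; rewrite -/M; nia.
exists t0, c, (fun t => if t == t0 then (h - \sum_(t | t != t0) e t)%N else e t).
split=> [|t|t /negPf tt0].
- rewrite (bigD1 t0) //= eqxx.
  rewrite [X in (_ + X)%N](eq_bigr e) => [|t /negPf -> //].
  exact/subnK/ltnW.
- case: eqP => [->|_]; [lia | exact: e_eq0].
- by rewrite tt0 cE; exact: mE.
Qed.

(** * The theorem *)

Lemma card_setT_le_ord (F : finType) : ([set: F] #<= `I_#|F|)%card.
Proof.
have rank_inj : injective (fun x : F => enum_rank x : nat).
  by move=> x y /ord_inj/enum_rank_inj.
rewrite -(card_le_eql (inj_card_eq (in2W rank_inj))).
by apply: subset_card_le => _ [x _ <-] /=; exact: ltn_ord.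
Qed.

Lemma union_monoid_translates_approx (G : zmodType) (r : nat) (A : set G) :
  (0 < r)%N -> union_monoid_translates A ->
  exists l : nat, (0 < l)%N /\ asymptotic_approx_group r l A.
Proof.
move=> r_gt0 [T [a [S [S_monoid AE]]]].
pose F := (T * {ffun T -> 'I_(2 * #|T| * r).+1})%type.
exists #|{: F}|.+1; split=> //; exists #|T|.+1; split=> // h lt_Th.
(* The term of index [p.1] vanishes, so the change of multiplicity there enters
   only through the change [h * r - h] of the total. *)
pose shift (p : F) : G := (a p.1 *+ (h * r - h) +
  \sum_t (a t - a p.1) *+ (h %/ #|T| * p.2 t))%R.
exists (range shift); split.
  apply: (card_le_trans (card_image_le _ _)).
  by apply: (card_le_trans (card_setT_le_ord _)); rewrite card_le_II.
move=> z /(nsumset_multiplicities S_monoid AE)[m [s [sum_m Ss s0 ->]]].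
have [t0 [c [g [sum_g g0 mE]]]] := rounded_multiplicities r_gt0 lt_Th sum_m.
exists (shift (t0, c)), (\sum_t (a t *+ g t + s t))%R; split.
- by exists (t0, c).
- rewrite -{1}sum_g; apply: (mem_nsumset_multiplicities S_monoid AE) => // t.
  by move=> /g0/s0.
- rewrite !big_split /= addrA; congr (_ + _)%R.
  rewrite !(sum_mulrn_recenter a t0) sum_m sum_g /shift /=.
  rewrite addrACA -mulrnDr subnK ?leq_pmulr // -big_split /=.
  congr (_ + _)%R; apply: eq_bigr => t _; rewrite -mulrnDr.
  by have [->|/mE->//] := eqVneq t t0; rewrite subrr !mul0rn.
Qed.

Theorem corollary1p6 (r k : nat) (hr : (0 < r)%N) (hk : (0 < k)%N)
    (G : zmodType) (A : set G)
    (hA : exists P : 'I_k -> set G,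
        (forall i : 'I_k, gap (P i)) /\ A = \bigcup_(i : 'I_k) P i) :
  exists l : nat, (0 < l)%N /\ asymptotic_approx_group r l A.
Proof.
have [P [P_gap ->]] := hA.
apply: union_monoid_translates_approx hr _.
by apply: bigcup_monoid_translates => i; exact: gap_monoid_translates.
Qed.
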